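(* Let $L, L', W, W'$ be sets with functions $\Lambda: L \times W \to \mathbf{R}$ and $\Lambda': L' \times W' \to \mathbf{R}$. If $C: L \rightrightarrows L'$ and $D: W \rightrightarrows W'$ are correspondences and $\varepsilon\in\mathbf{R}$ satisfies $\varepsilon \geq \mathrm{dis}(C,D)$, then the persistence modules $\mathrm{H}(\mathbb{D}\mathrm{ow}(\Lambda))$ and $\mathrm{H}(\mathbb{D}\mathrm{ow}(\Lambda'))$ are $\varepsilon$-interleaved.
   Context: Fix a field $\mathbf{k}$; $\mathrm{H}$ denotes (total) simplicial homology with coefficients in $\mathbf{k}$. A persistence module $\mathbb{V}$ is a family of $\mathbf{k}$-vector spaces $(V_a)_{a\in\mathbf{R}}$ with linear maps $v_a^b:V_a\to V_b$ for $a\le b$ such that $v_a^a=\mathrm{id}$ and $v_b^c\circ v_a^b=v_a^c$ for $a\le b\le c$. A homomorphism of degree $\varepsilon$, $\Phi\in\mathrm{Hom}^\varepsilon(\mathbb{U},\mathbb{V})$, is a family of linear maps $(\phi_a:U_a\to V_{a+\varepsilon})_{a\in\mathbf{R}}$ with $v_{a+\varepsilon}^{b+\varepsilon}\circ\phi_a=\phi_b\circ u_a^b$ for all $a\le b$. $\mathbb{U},\mathbb{V}$ are $\varepsilon$-interleaved if there are $\Phi\in\mathrm{Hom}^\varepsilon(\mathbb{U},\mathbb{V})$, $\Psi\in\mathrm{Hom}^\varepsilon(\mathbb{V},\mathbb{U})$ with $\psi_{a+\varepsilon}\circ\phi_a=u_a^{a+2\varepsilon}$ and $\phi_{a+\varepsilon}\circ\psi_a=v_a^{a+2\varepsilon}$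 for all $a$. A correspondence $C:X\rightrightarrows Y$ between sets is a subset of $X\times Y$ projecting surjectively onto both $X$ and $Y$. For correspondences $C:L\rightrightarrows L'$, $D:W\rightrightarrows W'$, the distortion of the pair is $$\mathrm{dis}(C,D)=\sup_{(l,l')\in C}\ \sup_{(w,w')\in D}|\Lambda(l,w)-\Lambda'(l',w')|\in[0,+\infty]$$ (with $\sup\emptyset=0$). Given $\Lambda:L\times W\to\mathbf{R}$ and $a\in\mathbf{R}$, the Dowker complex $\mathrm{Dow}(\Lambda,a)$ is the simplicial complex whose simplices are the nonempty finite subsets $\sigma\subseteq L$ for which there exists $w\in W$ with $\Lambda(l,w)\le a$ for all $l\in\sigma$. $\mathbb{D}\mathrm{ow}(\Lambda)$ is the filtered complex $(\mathrm{Dow}(\Lambda,a))_{a\in\mathbf{R}}$ and $\mathrm{H}(\mathbb{D}\mathrm{ow}(\Lambda))$ is the persistence module $(\mathrm{H}(\mathrm{Dow}(\Lambda,a)))_a$ with maps induced by inclusions. *)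

(* Defs.v *)
From HB Require Import structures.
From mathcomp Require Import all_boot all_order all_algebra generic_quotient ring_quotient.
From mathcomp Require Import finmap.
From mathcomp Require Import mathcomp_extra boolp classical_sets functions.
From mathcomp Require Import cardinality fsbigop reals constructive_ereal ereal.

Set Implicit Arguments.
Unset Strict Implicit.
Unset Printing Implicit Defensive.

Import Order.TTheory GRing.Theory Num.Theory.
Local Open Scope classical_set_scope.
Local Open Scope ring_scope.
Local Open Scope quotient_scope.

Section Homology.
Variables (k : fieldType) (C : lmodType k) (d : {linear C -> C}).

Definition is_cycle : {pred C} := fun c => d c == 0.

Lemma is_cycle_submod_closed : submod_closed is_cycle.
Proof.
split=> [|a u v]; rewrite !unfold_in ?linear0// => /eqP du /eqP dv.
by rewrite linearP du dv scaler0 addr0.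
Qed.
HB.instance Definition _ :=
  GRing.isSubmodClosed.Build k C is_cycle is_cycle_submod_closed.

Definition cycle := {c : C | c \in is_cycle}.
HB.instance Definition _ := [isSub of cycle for @sval _ _].
HB.instance Definition _ := [Choice of cycle by <:].
HB.instance Definition _ := [SubChoice_isSubLmodule of cycle by <:].

Definition is_boundary : {pred cycle} := fun z => `[< exists c, d c = val z >].

Lemma is_boundary_submod_closed : submod_closed is_boundary.
Proof.
split=> [|a u v]; first by apply/asboolP; exists 0; rewrite !linear0.
move=> /asboolP[x xu] /asboolP[y yv]; apply/asboolP; exists (a *: x + y).
by rewrite !linearP xu yv.
Qed.
HB.instance Definition _ :=
  GRing.isSubmodClosed.Build k cycle is_boundary is_boundary_submod_closed.

(* ker d / im d, for an endomorphism d of square zero. *)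
Definition homology := Quotient.quot is_boundary.
HB.instance Definition _ := GRing.Zmodule.on homology.
HB.instance Definition _ := EqQuotient.on homology.

Definition homology_class (z : cycle) : homology := \pi_homology z.

Lemma homology_class_repr (x : homology) : homology_class (repr x) = x.
Proof. exact: reprK. Qed.

Lemma homology_classP (z z' : cycle) :
  homology_class z = homology_class z' <-> exists c, d c = val z - val z'.
Proof.
split=> [/eqP|[c dc]]; last apply/eqP; rewrite /homology_class piE Quotient.equivE.
  by rewrite unfold_in => /asboolP[c dc]; exists c; rewrite dc raddfB.
by rewrite unfold_in; apply/asboolP; exists c; rewrite dc raddfB.
Qed.

Lemma homology_class_zmod : zmod_morphism homology_class.
Proof. by move=> x y; rewrite /homology_class !piE. Qed.
HB.instance Definition _ :=
  GRing.isZmodMorphism.Build cycle homology homology_class homology_class_zmod.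

Definition homology_scale (a : k) (x : homology) : homology :=
  homology_class (a *: repr x).

Lemma homology_scaleE a (z : cycle) :
  homology_scale a (homology_class z) = homology_class (a *: z).
Proof.
have [c dc] := (homology_classP _ _).1 (homology_class_repr (homology_class z)).
by apply/homology_classP; exists (a *: c); rewrite linearZ /= dc scalerBr.
Qed.

Lemma homology_ind (P : homology -> Prop) :
  (forall z, P (homology_class z)) -> forall x, P x.
Proof. by move=> Pz x; rewrite -[x]homology_class_repr; exact: Pz. Qed.

Lemma homology_scaleA a b x :
  homology_scale a (homology_scale b x) = homology_scale (a * b) x.
Proof. by elim/homology_ind: x => z; rewrite !homology_scaleE scalerA. Qed.
Lemma homology_scale1 : left_id 1 homology_scale.
Proof. by elim/homology_ind => z; rewrite homology_scaleE scale1r. Qed.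
Lemma homology_scaleDr : right_distributive homology_scale +%R.
Proof.
move=> a; elim/homology_ind => y; elim/homology_ind => z.
by rewrite -raddfD !homology_scaleE scalerDr raddfD.
Qed.
Lemma homology_scaleDl x : {morph homology_scale^~ x : a b / a + b}.
Proof.
by move=> a b; elim/homology_ind: x => z; rewrite !homology_scaleE scalerDl raddfD.
Qed.
HB.instance Definition _ := GRing.Zmodule_isLmodule.Build k homology
  homology_scaleA homology_scale1 homology_scaleDr homology_scaleDl.

Lemma homology_class_scalable : scalable homology_class.
Proof. by move=> a z; rewrite -homology_scaleE. Qed.
HB.instance Definition _ :=
  GRing.isScalable.Build k cycle homology *:%R homology_class homology_class_scalable.
End Homology.

Section HomologyMap.
Variables (k : fieldType) (C C' : lmodType k).
Variables (d : {linear C -> C}) (d' : {linear C' -> C'}).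
Variables (f : {linear C -> C'}) (fd : forall c, f (d c) = d' (f c)).

Lemma cycle_map_subproof (z : cycle d) : f (val z) \in is_cycle d'.
Proof. by rewrite unfold_in -fd (eqP (valP z)) linear0. Qed.

Definition cycle_map (z : cycle d) : cycle d' :=
  exist (fun c => c \in is_cycle d') (f (val z)) (cycle_map_subproof z).

Definition homology_map (x : homology d) : homology d' :=
  homology_class (cycle_map (repr x)).

Lemma homology_mapE (z : cycle d) :
  homology_map (homology_class z) = homology_class (cycle_map z).
Proof.
have [c dc] := (homology_classP _ _).1 (homology_class_repr (homology_class z)).
by apply/homology_classP; exists (f c); rewrite -fd dc linearB.
Qed.

Lemma homology_map_linear : linear homology_map.
Proof.
move=> a; elim/homology_ind => y; elim/homology_ind => z.
rewrite -linearP !homology_mapE -linearP; congr homology_class.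
by apply/val_inj; rewrite /= !linearP.
Qed.
HB.instance Definition _ :=
  GRing.isLinear.Build k (homology d) (homology d') *:%R homology_map homology_map_linear.
End HomologyMap.

Record complex (V : choiceType) := Complex {
  simplices : set {fset V};
  simplex_neq0 : forall s, simplices s -> s != fset0;
  simplex_face : forall s t, simplices s -> t != fset0 -> (t `<=` s)%fset ->
    simplices t }.

Section Chains.
Variables (k : fieldType) (V : choiceType).

(* Simplicial chains of all degrees at once, in Munkres' presentation: a chain
   assigns a coefficient [c s] to each oriented simplex [s = [v_0, ..., v_p]],
   changes sign when the orientation is reversed, and is nonzero on finitely many
   simplices only. Adjacent transpositions generate the symmetric group, so the
   last clause says that [c] is multiplied by the sign of a permutation of [s]. *)
Definition is_chain (K : complex V) : {pred (seq V -> k^o)} := fun c =>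
  `[< [/\ finite_set [set s | c s != 0],
      forall s, c s != 0 -> uniq s /\ simplices K [fset v in s]%fset &
      forall s u v t, c (s ++ u :: v :: t) = - c (s ++ v :: u :: t)] >].

Lemma is_chain_submod_closed K : submod_closed (is_chain K).
Proof.
split=> [|a c c' /asboolP[fc Kc ac] /asboolP[fc' Kc' ac']]; apply/asboolP.
  split=> [|s|s u v t]; last by rewrite [in RHS]/GRing.zero/= oppr0.
    rewrite (_ : mkset _ = set0); first exact: finite_set0.
    by apply/seteqP; split=> s //=; rewrite eqxx.
  by rewrite eqxx.
have nz s : (a *: c + c') s != 0 -> c s != 0 \/ c' s != 0.
  rewrite -[(_ + _) s]/(a *: c s + c' s) => nz.
  have [cs0|] := eqVneq (c s) 0; last by left.
  by right; move: nz; rewrite cs0 scaler0 add0r.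
split=> [|s /nz[/Kc|/Kc']//|s u v t].
  apply: (@sub_finite_set _ _ ([set s | c s != 0] `|` [set s | c' s != 0])).
    by move=> s /nz.
  by rewrite finite_setU.
rewrite -![(_ + _) (_ ++ _)]/(a *: c _ + c' _) ac ac' scalerN opprD.
by [].
Qed.
HB.instance Definition _ K := GRing.isSubmodClosed.Build k (seq V -> k^o)
  (is_chain K) (is_chain_submod_closed K).

Definition chain K := {c : seq V -> k^o | c \in is_chain K}.
HB.instance Definition _ K := [isSub of chain K for @sval _ _].
HB.instance Definition _ K := [Choice of chain K by <:].
HB.instance Definition _ K := [SubChoice_isSubLmodule of chain K by <:].

(* The linear map [v_0, ..., v_p] |-> \sum_i (-1)^i [v_0, .., v_i omitted, .., v_p],
   vanishing for p = 0, in terms of coefficients: [t] is a face of the oriented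
   simplices [v, t], with sign +1 (see [bdry_oriented_simplex]). *)
Definition bdry (c : seq V -> k^o) : seq V -> k^o := fun t =>
  if t is [::] then 0 else \sum_(v \in [set: V]) c (v :: t).

Lemma chain_support K (c : seq V -> k^o) : c \in is_chain K ->
  exists r : seq V, uniq r /\ forall s, c s != 0 -> {subset s <= r}.
Proof.
move=> /asboolP[/finite_seqP[S cS] _ _]; exists (undup (flatten S)).
split=> [|s cs v vs]; first exact: undup_uniq.
rewrite mem_undup; apply/flattenP; exists s => //.
by have : [set s | c s != 0] s by []; rewrite cS.
Qed.

Lemma bdry_sum (c : seq V -> k^o) (r t : seq V) : uniq r ->
    (forall s, c s != 0 -> {subset s <= r}) -> t != [::] ->
  bdry c t = \sum_(v <- r) c (v :: t).
Proof.
move=> ur cr; case: t => // u t _; rewrite /bdry [RHS]fsbig_seq//; apply/esym.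
apply: (fsbig_widen [set` r] setT) => // v [_ vr]; apply/eqP; apply/negPn/negP.
by move=> /cr rs; apply: vr; apply: rs; exact: mem_head.
Qed.

Lemma bdry_is_chain K (c : seq V -> k^o) : c \in is_chain K -> bdry c \in is_chain K.
Proof.
move=> cK; have [r [ur cr]] := chain_support cK.
have nz t : bdry c t != 0 -> t != [::] /\ exists v, c (v :: t) != 0.
  have [->|t0] := eqVneq t [::]; first by rewrite eqxx.
  rewrite (bdry_sum ur cr t0) => nz; split=> //; apply: contrapT => /forallNP c0.
  by move/eqP: nz; apply; apply: big1 => v _; have /negP/negPn/eqP := c0 v.
move: cK => /asboolP[fc Kc ac]; apply/asboolP; split.
- apply: (@sub_finite_set _ _ (behead @` [set s | c s != 0])); last exact: finite_image.
  by move=> t /nz[_ [v cv]]; exists (v :: t).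
- move=> t /nz[t0 [v /Kc[/andP[_ ut] Kt]]]; split=> //; apply: (simplex_face Kt).
    case: t t0 {ut Kt} => // u t _; apply/fset0Pn; exists u.
    by rewrite !inE eqxx.
  by apply/fsubsetP => u; rewrite !inE => ->; rewrite orbT.
- move=> s u v t; rewrite !(bdry_sum ur cr)//; try by case: (s).
  by rewrite -sumrN; apply: eq_bigr => w _; rewrite (ac (w :: s)).
Qed.

Definition chain_bdry K (c : chain K) : chain K :=
  exist (fun c => c \in is_chain K) (bdry (val c)) (bdry_is_chain (valP c)).

Lemma chain_bdry_linear K : linear (@chain_bdry K).
Proof.
move=> a c c'; apply/val_inj/funext => t /=; rewrite -[RHS]/(a *: bdry _ t + bdry _ t).
have [->|t0] := eqVneq t [::]; first by rewrite /= scaler0 addr0.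
have [r [ur cr]] := chain_support (valP c).
have [r' [ur' cr']] := chain_support (valP c').
have us : uniq (undup (r ++ r')) by exact: undup_uniq.
rewrite !(bdry_sum us _ t0).
- by rewrite scaler_sumr -big_split.
- by move=> s /cr' rs v /rs; rewrite mem_undup mem_cat => ->; rewrite orbT.
- by move=> s /cr rs v /rs; rewrite mem_undup mem_cat => ->.
- move=> s; rewrite -[_ s]/(a *: val c s + val c' s) => nz v vs.
  rewrite mem_undup mem_cat; have [cs0|/cr->//] := eqVneq (val c s) 0.
  by rewrite (cr' s) ?orbT//; move: nz; rewrite cs0 scaler0 add0r.
Qed.
HB.instance Definition _ K :=
  GRing.isLinear.Build k (chain K) (chain K) *:%R (@chain_bdry K) (@chain_bdry_linear K).

Lemma chain_bdry_bdry K (c : chain K) : chain_bdry (chain_bdry c) = 0.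
Proof.
apply/val_inj/funext => t; rewrite /= -[RHS]/0.
have [->//|t0] := eqVneq t [::].
have [r [ur cr]] := chain_support (valP c).
have [_ Kc ac] := asboolP _ (valP c).
have [r' [ur' cr']] := chain_support (bdry_is_chain (valP c)).
have us : uniq (undup (r ++ r')) by exact: undup_uniq.
rewrite (bdry_sum us _ t0); last first.
  by move=> s /cr' rs v /rs; rewrite mem_undup mem_cat => ->; rewrite orbT.
under eq_bigr => v _.
  rewrite (bdry_sum us)//; last first.
    by move=> s /cr rs u /rs; rewrite mem_undup mem_cat => ->.
  over.
elim: (undup _) => [|w s IHs]; first by rewrite big_nil.
rewrite !big_cons; under [X in _ + X]eq_bigr do rewrite big_cons.
rewrite big_split/= IHs addr0 -addrA -big_split/= big1 ?addr0.
  by apply: contraTeq isT => /Kc[/=]; rewrite mem_head.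
by move=> v _; rewrite (ac [::] w) subrr.
Qed.

(* The elementary chain of the oriented simplex [s]: its value at a permutation of
   [s] is the sign of that permutation, and it vanishes elsewhere. *)
Definition oriented_simplex (s : seq V) : seq V -> k^o := fun t =>
  if size t == size s
  then \det (\matrix_(i < size s, j < size s) (onth s i == onth t j)%:R) else 0.

Lemma onth_omit (s : seq V) i j :
  onth (take i s ++ drop i.+1 s) j = onth s (bump i j).
Proof.
by elim: s i j => [|x s IHs] [|i] [|j]; rewrite ?onth0n //= ?drop0 ?bumpS ?IHs.
Qed.

Lemma bdry_oriented_simplex (s : seq V) : (1 < size s)%N ->
  bdry (oriented_simplex s) =
  \sum_(i < size s) (-1) ^+ i *: oriented_simplex (take i s ++ drop i.+1 s).
Proof.
pose os p (s t : seq V) : k^o := if size t == p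
  then \det (\matrix_(i < p, j < p) (onth s i == onth t j)%:R) else 0.
have osE p s' : size s' = p -> oriented_simplex s' = os p s' by move=> <-.
case sp : (size s) => [|[|p]]// _; apply/funext => t; rewrite fct_sumE.
transitivity (\sum_(i < p.+2) (-1) ^+ i *: os p.+1 (take i s ++ drop i.+1 s) t); last first.
  apply: eq_bigr => i _; rewrite -[RHS]/(_ *: oriented_simplex _ t) (osE p.+1)//.
  by rewrite size_cat size_take size_drop sp ltn_ord subSS subnKC// -ltnS.
rewrite (osE _ _ sp).
case: (eqVneq (size t) p.+1) => [tp|tp]; last first.
  rewrite big1 => [|i _]; last by rewrite /os (negPf tp) scaler0.
  rewrite /bdry; case: t tp => // u t tp; apply: fsbig1 => v _.
  by rewrite /os /= eqSS (negPf tp).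
case: t tp => // u t tp; rewrite /bdry; move: {u t} (u :: t) tp => t tp.
pose M (v : V) : 'M[k]_p.+2 :=
  \matrix_(i < p.+2, j < p.+2) (onth s i == onth (v :: t) j)%:R.
have detM v : \det (M v) = \sum_(i < p.+2) (onth s i == Some v)%:R *
    ((-1) ^+ i *: os p.+1 (take i s ++ drop i.+1 s) t).
  rewrite (expand_det_col _ ord0); apply: eq_bigr => i _; rewrite mxE /=.
  congr (_ * _); rewrite /cofactor addn0 /os tp eqxx; congr (_ * \det _).
  by apply/matrixP => a b; rewrite !mxE /= onth_omit.
transitivity (\sum_(v \in [set: V]) \det (M v)).
  by apply: eq_fsbigr => v _; rewrite /os /= eqSS tp eqxx.
rewrite (_ : \sum_(v \in _) _ = \sum_(v <- undup s) \det (M v)).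
  under eq_bigr do rewrite detM.
  rewrite exchange_big; apply: eq_bigr => i _ /=.
  have : onth s i by rewrite onthTE sp.
  case si : (onth s i) => [w|]// _; have ws : w \in undup s.
    by rewrite mem_undup; apply/onthP; exists i.
  rewrite (bigD1_seq w) ?undup_uniq//= eqxx mul1r big1 ?addr0// => v vw.
  by rewrite [Some w == _]eq_sym (inj_eq Some_inj) (negPf vw) mul0r.
rewrite [RHS]fsbig_seq ?undup_uniq//; apply/esym.
apply: (fsbig_widen _ setT) => // v [_ /= vs].
rewrite /= detM big1// => i _; case: eqP => [siv|_]; last by rewrite mul0r.
by case: vs; rewrite mem_undup; apply/onthP; exists i.
Qed.
End Chains.

Section Inclusion.
Variables (k : fieldType) (V : choiceType) (K K' : complex V).
Variable KK' : simplices K `<=` simplices K'.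

Lemma is_chain_sub (c : seq V -> k^o) : c \in is_chain K -> c \in is_chain K'.
Proof.
move=> /asboolP[fc Kc ac]; apply/asboolP; split=> // s /Kc[us Ks].
by split=> //; exact: KK'.
Qed.

Definition chain_incl (c : chain k K) : chain k K' :=
  exist (fun c => c \in is_chain K') (val c) (is_chain_sub (valP c)).

Lemma chain_incl_linear : linear chain_incl.
Proof. by move=> a c c'; exact/val_inj. Qed.
HB.instance Definition _ :=
  GRing.isLinear.Build k (chain k K) (chain k K') *:%R chain_incl chain_incl_linear.

Lemma chain_incl_bdry c : chain_incl (chain_bdry c) = chain_bdry (chain_incl c).
Proof. exact/val_inj. Qed.
End Inclusion.

Section Persistence.
Variable R : realType.

Record filtered_complex (V : choiceType) := FilteredComplex {
  filtered_at :> R -> complex V;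
  filtered_sub : forall a b, a <= b ->
    simplices (filtered_at a) `<=` simplices (filtered_at b) }.

Variable k : fieldType.

Record persistence_module := PersistenceModule {
  pm_space :> R -> lmodType k;
  pm_map : forall a b, a <= b -> {linear pm_space a -> pm_space b};
  pm_map_id : forall a (aa : a <= a) x, pm_map aa x = x;
  pm_map_comp : forall a b c (ab : a <= b) (bc : b <= c) (ac : a <= c) x,
    pm_map bc (pm_map ab x) = pm_map ac x }.

Record pm_hom (e : R) (U V : persistence_module) := PMHom {
  pm_hom_fun :> forall a, {linear U a -> V (a + e)};
  pm_hom_natural : forall a b (ab : a <= b) (abe : a + e <= b + e) x,
    pm_map V abe (pm_hom_fun a x) = pm_hom_fun b (pm_map U ab x) }.

Lemma le_shift2 (e a : R) : 0 <= e -> a <= a + e + e.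
Proof. by move=> e0; rewrite -addrA lerDl addr_ge0. Qed.

(* The index a + 2e is spelled a + e + e, where the composites land. *)
Definition interleaved (e : R) (U V : persistence_module) : Prop :=
  exists (e0 : 0 <= e) (phi : pm_hom e U V) (psi : pm_hom e V U),
    (forall a x, psi (a + e) (phi a x) = pm_map U (le_shift2 a e0) x) /\
    (forall a x, phi (a + e) (psi a x) = pm_map V (le_shift2 a e0) x).

Section FilteredHomology.
Variables (V : choiceType) (K : filtered_complex V).

Definition simplicial_homology (L : complex V) : lmodType k :=
  homology (@chain_bdry k V L).

Definition filtered_homology_map a b (ab : a <= b) :
    {linear simplicial_homology (K a) -> simplicial_homology (K b)} :=
  homology_map (chain_incl_bdry (k := k) (@filtered_sub V K a b ab)).

Lemma filtered_homology_map_id a (aa : a <= a) x : filtered_homology_map aa x = x.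
Proof.
elim/homology_ind: x => z; rewrite /filtered_homology_map /= homology_mapE.
by congr homology_class; do 2!apply/val_inj.
Qed.

Lemma filtered_homology_map_comp a b c (ab : a <= b) (bc : b <= c) (ac : a <= c) x :
  filtered_homology_map bc (filtered_homology_map ab x) = filtered_homology_map ac x.
Proof.
elim/homology_ind: x => z; rewrite /filtered_homology_map /= !homology_mapE.
by congr homology_class; do 2!apply/val_inj.
Qed.

Definition persistent_homology : persistence_module :=
  PersistenceModule filtered_homology_map_id filtered_homology_map_comp.
End FilteredHomology.
End Persistence.

Section Dowker.
Variables (R : realType) (L W : Type) (Lam : L -> W -> R).

Definition dowker_simplices (a : R) : set {fset {classic L}} :=
  [set s : {fset {classic L}} | s != fset0 /\
    exists w, forall l : {classic L}, l \in s -> Lam l w <= a].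

Lemma dowker_neq0 a s : dowker_simplices a s -> s != fset0.
Proof. by case. Qed.

Lemma dowker_face a s t : dowker_simplices a s -> t != fset0 -> (t `<=` s)%fset ->
  dowker_simplices a t.
Proof.
by move=> [_ [w sw]] t0 /fsubsetP ts; split=> //; exists w => l /ts; exact: sw.
Qed.

Definition dowker_at (a : R) : complex {classic L} :=
  Complex (@dowker_neq0 a) (@dowker_face a).

Lemma dowker_at_sub a b : a <= b ->
  simplices (dowker_at a) `<=` simplices (dowker_at b).
Proof.
by move=> ab s [s0 [w sw]]; split=> //; exists w => l /sw /le_trans; apply.
Qed.

Definition Dow : filtered_complex R {classic L} := FilteredComplex dowker_at_sub.
End Dowker.

Definition correspondence (X Y : Type) (C : set (X * Y)) : Prop :=
  (forall x, exists y, C (x, y)) /\ (forall y, exists x, C (x, y)).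

(* Supremum in [0, +oo], where the supremum of the empty set is 0. *)
Definition sup_ge0 (R : realType) (S : set \bar R) : \bar R :=
  ereal_sup (0%E |` S).

Definition dis (R : realType) (L L' W W' : Type)
    (Lam : L -> W -> R) (Lam' : L' -> W' -> R)
    (C : set (L * L')) (D : set (W * W')) : \bar R :=
  sup_ge0 [set sup_ge0 [set `|Lam l.1 w.1 - Lam' l.2 w.2|%:E | w in D] | l in C].

(* Main.v *)
Require Import Defs.
From HB Require Import structures.
From mathcomp Require Import all_boot all_order all_algebra.
From mathcomp Require Import finmap.
From mathcomp Require Import boolp functions cardinality.
From mathcomp Require Import classical_sets reals constructive_ereal ereal.

Local Open Scope ring_scope.
Import Order.TTheory GRing.Theory Num.Theory.

Set Implicit Arguments.
Unset Strict Implicit.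
Unset Printing Implicit Defensive.

(** The correspondences supply vertex maps [f : L -> L'] and [g : L' -> L] with
    [(l, f l)] and [(g l', l')] in [C]. If [w] witnesses a simplex at level [a]
    and [(w, w')] is in [D], then [w'] witnesses its image under [f] at level
    [a + eps], so [f] and likewise [g] are simplicial up to a shift by [eps]
    ([dowker_simplicial]). Going there and back, the same [w] witnesses the union
    of a simplex and its image under [g \o f] at level [a + 2 * eps]: the map
    [g \o f] is contiguous to the inclusion ([dowker_contiguous]). Contiguous maps
    agree in homology, which gives the two interleaving identities
    ([interleaved_contiguous]).

    What remains is functoriality of homology and its invariance under contiguity.
    A chain is an alternating function on sequences of vertices, hence an element
    of an exterior algebra written in coordinates, and the arguments below use the
    calculus of that algebra. Contraction with a vertex [v] reads off the
    coefficients [c (v :: s)]; the boundary is the sum of all contractions;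
    [cone u] is exterior multiplication by [u], so that it satisfies a Leibniz rule
    and [d (u /\ c) = c - u /\ d c]; the push-forward [push r f] is the algebra map
    induced by [f]. All of these are determined by their contractions and their
    values at the empty sequence, so identities between them are proved by induction
    on the sequence at which they are evaluated.

    The usual prism operator needs an ordering of the vertices. Instead, contiguous
    maps [f] and [g] are joined by maps that change one vertex [v] at a time
    ([push_homologous]). Write [c = v /\ a + b], where [a] is the contraction of [c]
    with [v], and [b] does not involve [v]. If [f] and [g] differ only at [v], then
    [f_* c - g_* c = f v /\ f_* a - g v /\ f_* a], and this is the boundary of
    [g v /\ f v /\ f_* a] when [c] is a cycle, because contraction anticommutes
    with the boundary ([push_homologous_step]). No division is involved, so the
    characteristic of the field does not matter. *)

(** * Sums and simplices *)

(** The diagonal hypothesis is what makes this valid in characteristic 2. *)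
Lemma sum_antisymmetric (A : zmodType) (I : Type) (r : seq I) (P : pred I)
    (F : I -> I -> A) : (forall v w, F v w = - F w v) -> (forall v, F v v = 0) ->
  \sum_(v <- r | P v) \sum_(w <- r | P w) F v w = 0.
Proof.
move=> FN F0; rewrite -big_filter; under eq_bigr do rewrite -big_filter.
elim: [seq v <- r | P v] => [|v s IHs]; first by rewrite big_nil.
rewrite !big_cons F0 add0r; under [X in _ + X]eq_bigr do rewrite big_cons.
rewrite big_split /= IHs addr0 -big_split /= big1// => w _.
by rewrite [F v w]FN addNr.
Qed.

Lemma big_pred1_uniq (A : nmodType) (I : eqType) (r : seq I) (i : I) (F : I -> A) :
  uniq r -> i \in r -> \sum_(j <- r | j == i) F j = F i.
Proof.
move=> ur ir; rewrite big_mkcond (bigD1_seq i)//= eqxx big1 ?addr0// => j.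
by case: eqP.
Qed.

Lemma in_fset_seq (V : choiceType) (s : seq V) (x : V) :
  (x \in [fset v in s]%fset) = (x \in s).
Proof. by rewrite !inE. Qed.

Lemma fset_seq_neq0 (V : choiceType) (s : seq V) :
  ([fset v in s]%fset != fset0) = (s != [::]).
Proof.
case: s => [|u s]; last by apply/fset0Pn; exists u; rewrite in_fset_seq mem_head.
by rewrite eqxx; apply/negP; apply; apply/eqP/fsetP => v; rewrite in_fset_seq.
Qed.

Lemma simplices_subset (V : choiceType) (K : complex V) (s t : seq V) :
    simplices K [fset v in s]%fset -> t != [::] -> {subset t <= s} ->
  simplices K [fset v in t]%fset.
Proof.
move=> Ks t0 ts; apply: simplex_face Ks _ _.
  by rewrite fset_seq_neq0.
by apply/fsubsetP => u; rewrite !in_fset_seq => /ts.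
Qed.

(** * Alternating coefficient functions and the cone operator *)

Section Coefficients.
Variables (k : fieldType) (V : choiceType).
Implicit Types (c : seq V -> k^o) (r s t : seq V) (u v x : V).

Definition contract v c : seq V -> k^o := fun s => c (v :: s).

Definition supported r c := forall s, c s != 0 -> {subset s <= r}.

(** The second clause follows from the first outside characteristic 2. Stated on
    its own, it lets uniqueness of the vertices in the support be recovered for
    functions that are not yet known to be chains of a complex. *)
Definition alternating c :=
  (forall s u v t, c (s ++ u :: v :: t) = - c (s ++ v :: u :: t)) /\
  (forall s u t, c (s ++ u :: u :: t) = 0).

Lemma contract_is_linear v : linear (contract v).
Proof. by move=> a c c'; apply/funext. Qed.
HB.instance Definition _ v := GRing.isLinear.Build k (seq V -> k^o) (seq V -> k^o)
  *:%R (contract v) (contract_is_linear v).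

Lemma coefB c c' s : (c - c') s = c s - c' s. Proof. by []. Qed.

Lemma alternating_contract v c : alternating c -> alternating (contract v c).
Proof.
by move=> [sw rp]; split=> s *; [exact: (sw (v :: s)) | exact: (rp (v :: s))].
Qed.

Lemma contractC u v c : alternating c ->
  contract u (contract v c) = - contract v (contract u c).
Proof. by move=> [sw _]; apply/funext => s; exact: (sw [::]). Qed.

Lemma contractK u c : alternating c -> contract u (contract u c) = 0.
Proof. by move=> [_ rp]; apply/funext => s; exact: (rp [::]). Qed.

Lemma alternatingB c c' : alternating c -> alternating c' -> alternating (c - c').
Proof.
move=> [sw rp] [sw' rp']; split=> [s u v t|s u t]; rewrite !coefB.
  by rewrite sw sw' opprD.
by rewrite rp rp' subrr.
Qed.

(** Adjacent swaps move an occurrence of [v] to the head, at the cost of a sign. *)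
Lemma alternating_notin v c s :
  alternating c -> contract v c = 0 -> c s != 0 -> v \notin s.
Proof.
move=> [sw _] cv0; apply: contra => /path.splitPr[p q]; apply/eqP.
elim/last_ind: p q => [|p x IHp] q; first exact: (congr1 (@^~ q) cv0).
by rewrite cat_rcons sw IHp oppr0.
Qed.

Lemma alternating_uniq c s : alternating c -> c s != 0 -> uniq s.
Proof.
elim: s c => //= x s IHs c ac cxs; have ax := alternating_contract x ac.
by rewrite (alternating_notin ax (contractK x ac) cxs) (IHs _ ax cxs).
Qed.

Lemma supported_contract r v c : supported r c -> supported r (contract v c).
Proof. by move=> rc s /rc rs u us; apply: rs; rewrite inE us orbT. Qed.

Lemma supportedS r r' c : {subset r <= r'} -> supported r c -> supported r' c.
Proof. by move=> rr' rc s /rc rs u /rs /rr'. Qed.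

Lemma contract_supported r v c : supported r c -> v \notin r -> contract v c = 0.
Proof.
move=> rc vr; apply/funext => s; apply/eqP; apply: contraNT vr => /rc.
by apply; exact: mem_head.
Qed.

Lemma chain_alternating (K : complex V) c : c \in is_chain K -> alternating c.
Proof.
move=> /asboolP[_ Kc sw]; split=> // s u t; apply/eqP; apply: contraT => /Kc[].
by rewrite cat_uniq /= mem_head /= !andbF.
Qed.

Lemma chain_nil (K : complex V) c : c \in is_chain K -> c [::] = 0.
Proof.
move=> /asboolP[_ Kc _]; apply/eqP; apply: contraT => /Kc[_ /simplex_neq0].
by rewrite fset_seq_neq0.
Qed.

Lemma finite_uniq_seqs r : finite_set [set s : seq V | uniq s /\ {subset s <= r}].
Proof.
pose T := seq_sub r.
apply: (@sub_finite_set _ _ ((fun b : {bseq size r of T} => map val (val b)) @` setT)).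
  move=> s [us /[dup] sr /allP sr']; have [t ts] : exists t : seq T, map val t = s.
    exists (pmap insub s); rewrite (pmap_filter (insubK _)); apply/all_filterP.
    by apply/allP => x /sr xr; rewrite insubT.
  have tr : (size t <= size r)%N by rewrite -(size_map val) ts uniq_leq_size.
  by exists (Bseq tr).
by apply: finite_image; exact: finite_finset.
Qed.

(** Alternation excludes repeated vertices, and only finitely many sequences without
    repetition fit in [r], so a bound on the vertices implies finite support. *)
Lemma is_chainI (K : complex V) c r : alternating c -> supported r c ->
    (forall s, c s != 0 -> s != [::] /\
      exists s', simplices K [fset v in s']%fset /\ {subset s <= s'}) ->
  c \in is_chain K.
Proof.
move=> ac rc Kc; apply/asboolP; split; last by case: ac.
  apply: sub_finite_set (finite_uniq_seqs r) => s cs; split; last exact: rc.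
  exact: alternating_uniq cs.
move=> s cs; split; first exact: alternating_uniq cs.
have [s0 [s' [Ks' ss']]] := Kc s cs; exact: simplices_subset Ks' s0 ss'.
Qed.

(** On functions supported in [r], this is the boundary of the augmented complex:
    its value at [[::]] is the augmentation, whereas [bdry] is zero there. Being a
    finite sum with fixed range, it is linear without any support condition. *)
Definition aug_bdry r c : seq V -> k^o := \sum_(v <- r) contract v c.

Lemma bdryE r c t : uniq r -> supported r c -> t != [::] ->
  bdry c t = aug_bdry r c t.
Proof. by move=> ur rc t0; rewrite (bdry_sum ur rc t0) /aug_bdry fct_sumE. Qed.

Lemma supported_bdry r c : uniq r -> supported r c -> supported r (bdry c).
Proof.
move=> ur rc [|u s]; first by rewrite eqxx.
rewrite (bdryE ur rc)// /aug_bdry fct_sumE => nz; apply: contrapT => nsr.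
move/eqP: nz; apply; apply: big1 => v _; apply/eqP; apply: contraT => /rc vsr.
by case: nsr => x xs; apply: vsr; rewrite inE xs orbT.
Qed.

Lemma contract_bdry r v c : uniq r -> supported r c ->
  contract v (bdry c) = contract v (aug_bdry r c).
Proof. by move=> ur rc; apply/funext => t; exact: bdryE. Qed.

Lemma aug_bdry_contract r v c : alternating c ->
  aug_bdry r (contract v c) = - contract v (aug_bdry r c).
Proof.
by move=> ac; rewrite raddf_sum -sumrN; apply: eq_bigr => u _; exact: contractC.
Qed.

(** Exterior multiplication by [u], given by the Leibniz rule for contractions. On
    oriented simplices it is [[v_0, ..., v_p] |-> [u, v_0, ..., v_p]]. *)
Fixpoint cone u c (t : seq V) : k^o :=
  if t is x :: t' then (if x == u then c t' else 0) - cone u (contract x c) t'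
  else 0.

Lemma cone_is_linear u : linear (cone u).
Proof.
move=> a c c'; apply/funext; move=> t; rewrite -[RHS]/(a *: cone u c t + cone u c' t).
elim: t c c' => [|x t IHt] c c' /=; first by rewrite scaler0 addr0.
rewrite linearP IHt scalerBr addrACA -opprD; congr (_ - _).
by case: eqP => // _; rewrite scaler0 addr0.
Qed.
HB.instance Definition _ u := GRing.isLinear.Build k (seq V -> k^o) (seq V -> k^o)
  *:%R (cone u) (cone_is_linear u).

Lemma contract_cone x u c :
  contract x (cone u c) = (if x == u then c else 0) - cone u (contract x c).
Proof. by apply/funext => t; rewrite coefB /contract /=; case: eqP. Qed.

Lemma cone_alternating u c : alternating c -> alternating (cone u c).
Proof.
move=> ac; split=> s; last first.
  move=> x t; elim: s c ac => [|y s IHs] c ac.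
    rewrite /= contractK// linear0 /= -/(contract x c t) subr0.
    by case: eqP; rewrite subrr.
  rewrite /= IHs ?subr0; last exact: alternating_contract.
  by case: eqP => // _; case: ac => _ ->.
move=> x y t; elim: s c ac => [|z s IHs] c ac.
  rewrite /= contractC// linearN /= /contract.
  by rewrite -[(- cone _ _) t]/(- cone _ _ t) !opprB addrA.
rewrite /= IHs; last exact: alternating_contract.
by rewrite opprB opprK addrC; case: eqP => _; [case: ac => -> | rewrite oppr0].
Qed.

Lemma cone_neq0 u c t : cone u c t != 0 ->
  exists s, c s != 0 /\ {subset t <= u :: s}.
Proof.
elim: t c => [|x t IHt] c /=; first by rewrite eqxx.
have [->|xu] := eqVneq x u; last first.
  rewrite sub0r oppr_eq0 => /IHt[s [cs ts]]; exists (x :: s); split=> // v.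
  rewrite !inE => /orP[->|/ts]; first by rewrite orbT.
  by rewrite inE => /orP[] ->; rewrite ?orbT.
have [ct0|ct _] := eqVneq (c t) 0; last by exists t; split.
rewrite ct0 sub0r oppr_eq0 => /IHt[s [cs ts]]; exists (u :: s); split=> // v.
by rewrite !inE => /orP[->//|/ts]; rewrite inE => /orP[] ->; rewrite ?orbT.
Qed.

Lemma supported_cone r u c : u \in r -> supported r c -> supported r (cone u c).
Proof.
move=> ur rc t /cone_neq0[s [/rc sr ts]] v /ts; rewrite inE => /orP[/eqP->//|].
exact: sr.
Qed.

(** Summing the Leibniz rule over all vertices shows that the cone is a contracting
    homotopy of the augmented complex. *)
Lemma aug_bdry_cone r u c : uniq r -> u \in r ->
  aug_bdry r (cone u c) = c - cone u (aug_bdry r c).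
Proof.
move=> ur u_r; rewrite /aug_bdry raddf_sum /=.
under eq_bigr do rewrite contract_cone.
rewrite big_split /= sumrN; congr (_ - _).
by rewrite -big_mkcond /= big_pred1_uniq.
Qed.

(** The contraction of [v /\ i_v c] with [v] is [i_v c], since [i_v i_v c = 0];
    the remainder of [c] therefore has zero contraction with [v]. *)
Lemma cone_contract_notin v c s : alternating c ->
  (c - cone v (contract v c)) s != 0 -> v \notin s.
Proof.
move=> ac; apply: alternating_notin.
  by apply: alternatingB => //; apply/cone_alternating/alternating_contract.
by rewrite raddfB /= contract_cone eqxx contractK// linear0 subr0 subrr.
Qed.

End Coefficients.

(** * Push-forward along a vertex map *)

Section Push.
Variables (k : fieldType) (V V' : choiceType).
Implicit Types (c : seq V -> k^o) (r s : seq V) (f g : V -> V').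

(** For [r] without duplicates, the value at [t] is the sum of [c s] over the
    sequences [s] in [r] with [map f s = t], so degenerate images cancel when [c] is alternating. The explicit
    range [r] keeps [push r f] linear on all functions; the choice of [r] is
    immaterial on functions supported in it, by [push_supported]. *)
Fixpoint push r f c (t : seq V') : k^o :=
  if t is u :: t' then \sum_(v <- r | f v == u) push r f (contract v c) t'
  else c [::].

Lemma push_is_linear r f : linear (push r f).
Proof.
move=> a c c'; apply/funext => t.
rewrite -[RHS]/(a *: push r f c t + push r f c' t).
elim: t c c' => [|u t IHt] c c' //=.
by under eq_bigr do rewrite linearP IHt; rewrite big_split scaler_sumr.
Qed.
HB.instance Definition _ r f := GRing.isLinear.Build k
  (seq V -> k^o) (seq V' -> k^o) *:%R (push r f) (push_is_linear r f).

Lemma contract_push r f u c :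
  contract u (push r f c) = \sum_(v <- r | f v == u) push r f (contract v c).
Proof. by apply/funext => t; rewrite fct_sumE. Qed.

Lemma push_neq0 r f c t : push r f c t != 0 -> exists2 s, c s != 0 & map f s = t.
Proof.
elim: t c => [|u t IHt] c /=; first by exists [::].
move=> nz; apply: contrapT => nex; move/eqP: nz; apply.
apply: big1 => v /eqP fv; apply/eqP; apply: contraT => /IHt[s cs st].
by case: nex; exists (v :: s); rewrite //= fv st.
Qed.

Lemma eq_push r f g c :
  (forall s, c s != 0 -> {in s, f =1 g}) -> push r f c = push r g c.
Proof.
move=> fg; apply/funext => t; elim: t c fg => // u t IHt c fg /=.
rewrite big_mkcond [RHS]big_mkcond; apply: eq_bigr => v _.
rewrite -IHt; last by move=> s /fg fgs x xs; apply: fgs; rewrite inE xs orbT.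
have [cv0|nz] := pselect (contract v c = 0).
  by rewrite cv0 linear0; do 2!case: ifP.
have [s cs] : exists s, c (v :: s) != 0.
  apply: contrapT => /forallNP c0; apply: nz; apply/funext => s.
  by apply/eqP; have /negP/negPn := c0 s.
by rewrite (fg _ cs) ?mem_head.
Qed.

Lemma push_supported r r' f c : uniq r -> uniq r' ->
  supported r c -> supported r' c -> push r f c = push r' f c.
Proof.
move=> ur ur' rc rc'; apply/funext => t.
elim: t c rc rc' => // u t IHt c rc rc' /=.
transitivity (\sum_(v <- r | f v == u) push r' f (contract v c) t).
  by apply: eq_bigr => v _; apply: IHt; exact: supported_contract.
apply: perm_big_supp; apply: uniq_perm; rewrite ?filter_uniq// => v.
rewrite !mem_filter; case: eqP => //= /eqP nz; apply/idP/idP => _.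
  by apply: contraNT nz => vr; rewrite (contract_supported rc' vr) linear0.
by apply: contraNT nz => vr; rewrite (contract_supported rc vr) linear0.
Qed.

Lemma push_alternating r f c : alternating c -> alternating (push r f c).
Proof.
move=> ac; split=> s.
  move=> x y t; elim: s c ac => [|z s IHs] c ac /=.
    rewrite exchange_big -sumrN; apply: eq_bigr => v _.
    rewrite -sumrN; apply: eq_bigr => w _.
    by rewrite contractC// linearN.
  by rewrite -sumrN; apply: eq_bigr => v _; apply/IHs/alternating_contract.
move=> x t; elim: s c ac => [|z s IHs] c ac /=; last first.
  by apply: big1 => v _; apply/IHs/alternating_contract.
apply: sum_antisymmetric => [v w|v]; first by rewrite contractC// linearN.
by rewrite contractK// linear0.
Qed.

Lemma push_cone r f u c : uniq r -> u \in r ->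
  push r f (cone u c) = cone (f u) (push r f c).
Proof.
move=> ur u_r; apply/funext => t; elim: t c => // x t IHt c /=.
rewrite contract_push raddf_sum fct_sumE.
under eq_bigr => v _ do rewrite contract_cone linearB /= coefB IHt.
rewrite big_split /= sumrN; congr (_ - _).
rewrite (eq_bigr (fun v => if v == u then push r f c t else 0)); last first.
  by move=> v _; case: eqP => // _; rewrite linear0.
rewrite -big_mkcondr (eq_bigl (fun v => (v == u) && (x == f u))).
  by rewrite big_mkcondr /= big_pred1_uniq.
by move=> v; rewrite andbC; case: eqP => //= ->; exact: eq_sym.
Qed.

Lemma aug_bdry_push r (r' : seq V') f c : uniq r' -> {subset map f r <= r'} ->
  aug_bdry r' (push r f c) = push r f (aug_bdry r c).
Proof.
move=> ur' rr'; rewrite /aug_bdry raddf_sum /=.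
under eq_bigr do rewrite contract_push.
rewrite (exchange_big_dep xpredT)//= big_seq [RHS]big_seq; apply: eq_bigr => v vr.
by rewrite (eq_bigl (pred1 (f v))) ?big_pred1_uniq// ?rr' ?map_f.
Qed.

(** With [c = v /\ a + b], where [b] does not involve [v], both maps agree on [a]
    and [b], and push-forward is multiplicative. *)
Lemma push_change_vertex r f g v c : uniq r -> v \in r -> alternating c ->
    (forall u, u != v -> f u = g u) ->
  push r f c - push r g c =
  cone (f v) (push r f (contract v c)) - cone (g v) (push r f (contract v c)).
Proof.
move=> ur vr ac fg; set a := contract v c; set b := c - cone v a.
have bE : push r f b = push r g b.
  apply: eq_push => s /(cone_contract_notin ac) vs u us.
  by apply: fg; apply: contraNneq vs => <-.
have aE : push r f a = push r g a.
  apply: eq_push => s cs u us; apply: fg; apply: contraTneq us => ->.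
  by have /= /andP[] := alternating_uniq (s := v :: s) ac cs.
have pE h : push r h c = push r h b + cone (h v) (push r h a).
  by rewrite -push_cone// -linearD /= subrK.
by rewrite !pE bE -aE opprD addrACA subrr add0r.
Qed.

(** The two boundaries differ only at [[::]], which contractions do not see. *)
Lemma contract_push_bdry r f u c : uniq r -> supported r c ->
  contract u (push r f (bdry c)) = contract u (push r f (aug_bdry r c)).
Proof.
move=> ur rc; rewrite !contract_push; apply: eq_bigr => v _.
by rewrite (contract_bdry _ ur rc).
Qed.

End Push.

Section PushFunctorial.
Variables (k : fieldType) (V V' V'' : choiceType).

Lemma push_comp r (r' : seq V') (f : V -> V') (g : V' -> V'') (c : seq V -> k^o) :
    uniq r' -> {subset map f r <= r'} ->
  push r' g (push r f c) = push r (g \o f) c.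
Proof.
move=> ur' rr'; apply/funext => t; elim: t c => // u t IHt c /=.
under eq_bigr do rewrite contract_push raddf_sum fct_sumE.
rewrite (exchange_big_dep (fun v => g (f v) == u))/=; last first.
  by move=> w v /eqP <- /eqP ->.
rewrite big_seq_cond [RHS]big_seq_cond; apply: eq_bigr => v /andP[vr /eqP gfv].
rewrite (eq_bigl (pred1 (f v))) ?big_pred1_uniq ?rr' ?map_f//.
by move=> w /=; rewrite andbC [f v == w]eq_sym; case: eqP => //= ->; apply/eqP.
Qed.

Lemma push_id r (c : seq V -> k^o) : uniq r -> supported r c -> push r id c = c.
Proof.
move=> ur rc; apply/funext => t; elim: t c rc => // u t IHt c rc /=.
have [ur'|ur'] := boolP (u \in r).
  by rewrite big_pred1_uniq// IHt//; exact: supported_contract.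
rewrite big_seq_cond big_pred0; last first.
  by move=> v; apply/negP => /andP[vr /eqP vu]; rewrite -vu vr in ur'.
by rewrite -[RHS]/(contract u c t) (contract_supported rc ur').
Qed.
End PushFunctorial.

(** * Contiguous maps are homologous *)

Section Contiguity.
Variables (V V' : choiceType) (K : complex V) (K' : complex V').
Implicit Types (f g : V -> V').

Definition simplicial f := forall s,
  simplices K [fset v in s]%fset -> simplices K' [fset v in map f s]%fset.

Definition contiguous f g := forall s,
  simplices K [fset v in s]%fset -> simplices K' [fset v in map f s ++ map g s]%fset.

Variable k : fieldType.

Lemma push_is_chain r f (c : seq V -> k^o) : simplicial f -> c \in is_chain K ->
  push r f c \in is_chain K'.
Proof.
move=> sf cK; have [r' [ur' rc]] := chain_support cK.
have [_ Kc _] := asboolP _ cK.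
apply: (is_chainI (r := map f r')).
- exact/push_alternating/(chain_alternating cK).
- by move=> t /push_neq0[s /rc sr <-] v /mapP[u /sr ur ->]; exact: map_f.
- move=> t /push_neq0[s cs <-]; have [_ Ks] := Kc _ cs; split.
    by apply: contraNneq cs; case: (s) => // _; rewrite (chain_nil cK).
  by exists (map f s); split=> //; exact: sf.
Qed.

(** The bounding chain is [g v /\ f v /\ f_* (i_v z)]. Its support lies over
    simplices [v :: s] of [z], with vertices in [f v :: g v :: map f s], so
    contiguity places it in [K']. *)
Lemma push_homologous_step r f g v (z : seq V -> k^o) :
    uniq r -> supported r z -> v \in r -> contiguous f g ->
    (forall u, u != v -> f u = g u) -> z \in is_chain K -> bdry z = 0 ->
  exists2 w, w \in is_chain K' & bdry w = push r f z - push r g z.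
Proof.
move=> ur rz vr fg fgv zK dz; have az := chain_alternating zK.
have [_ Kz _] := asboolP _ zK.
pose a := push r f (contract v z).
(* The order of the two cones fixes the sign: the outer one is removed first. *)
pose w := cone (g v) (cone (f v) a).
pose r' := undup (map f r ++ map g r).
have ur' : uniq r' by exact: undup_uniq.
have fr' u : u \in r -> f u \in r'.
  by move=> ?; rewrite mem_undup mem_cat map_f.
have gr' u : u \in r -> g u \in r'.
  by move=> ?; rewrite mem_undup mem_cat map_f ?orbT.
have aa : alternating a by exact/push_alternating/alternating_contract.
have ra : supported r' a.
  move=> t /push_neq0[s zs <-] x /mapP[u us ->]; apply: fr'.
  by apply: (supported_contract rz zs).
have rw : supported r' w by apply/supported_cone/supported_cone/ra; auto.
exists w.
  apply: is_chainI rw _; first by do 2!apply: cone_alternating.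
  move=> t wt; split; first by apply: contraNneq wt => ->.
  have [t1 [wt1 tt1]] := cone_neq0 wt.
  have [t2 [/push_neq0[s zs st2] t12]] := cone_neq0 wt1.
  exists (map f (v :: s) ++ map g (v :: s)); split.
    by apply: fg; have [_] := Kz _ zs.
  move=> x /tt1; rewrite mem_cat /= !inE => /orP[->|/t12]; first by rewrite !orbT.
  by rewrite inE -st2 => /orP[] ->; rewrite ?orbT.
apply/funext => t; have [->|t0] := eqVneq t [::].
  by rewrite coefB /= subrr.
rewrite (bdryE ur' rw t0) (push_change_vertex ur vr az fgv) aug_bdry_cone ?gr'//.
rewrite aug_bdry_cone ?fr'//.
(* Contraction with [v] evaluates the boundary of [z] at nonempty sequences only,
   where [bdry] and [aug_bdry] coincide. *)
suff -> : aug_bdry r' a = 0 by rewrite linear0 subr0.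
rewrite aug_bdry_push//; last by move=> x /mapP[u /fr' ? ->].
rewrite aug_bdry_contract// -(contract_bdry _ ur rz) dz.
by rewrite (linear0 (contract v)) oppr0 linear0.
Qed.

(** The maps [h l] move from [f] to [g] one vertex at a time. Any two of them send a
    simplex into the union of its images under [f] and [g], hence consecutive ones
    are contiguous. *)
Lemma push_homologous r f g (z : seq V -> k^o) :
    uniq r -> supported r z -> contiguous f g ->
    z \in is_chain K -> bdry z = 0 ->
  exists2 w, w \in is_chain K' & bdry w = push r f z - push r g z.
Proof.
move=> ur rz fg zK dz.
pose h (l : seq V) u := if u \in l then g u else f u.
have hfg l u : h l u = f u \/ h l u = g u.
  by rewrite /h; case: ifP; [right|left].
suff H l : {subset l <= r} ->
  exists2 w : chain k K', True & bdry (val w) = push r f z - push r (h l) z.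
  have [//|w _ dw] := H r; exists (val w); first exact: valP.
  rewrite dw (@eq_push _ _ _ _ (h r) g)// => s /rz sr u /sr ur'.
  by rewrite /h ur'.
elim: l => [|v l IHl] lr.
  exists 0 => //; rewrite -[LHS]/(val (chain_bdry (0 : chain k K'))) linear0.
  by rewrite (_ : h [::] = f) ?subrr.
have [|w _ dw] := IHl; first by move=> u ul; apply: lr; rewrite inE ul orbT.
have [| | |w' w'K dw'] :=
  @push_homologous_step r (h l) (h (v :: l)) v z ur rz _ _ _ zK dz.
- by apply: lr; exact: mem_head.
- move=> s /fg Ks; case: s Ks => [|u s] Ks; first exact: Ks.
  apply: simplices_subset Ks _ _ => // x.
  rewrite !mem_cat => /orP[] /mapP[y ys ->].
    by have [->|->] := hfg l y; rewrite map_f ?orbT.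
  by have [->|->] := hfg (v :: l) y; rewrite map_f ?orbT.
- by move=> u uv; rewrite /h inE (negPf uv).
exists (w + exist _ w' w'K : chain k K') => //.
rewrite -[LHS]/(val (chain_bdry (w + exist _ w' w'K : chain k K'))) linearD.
rewrite -[LHS]/(bdry (val w) + bdry w') dw dw'.
by rewrite addrA subrK.
Qed.
End Contiguity.

(** * Induced maps on chains and on persistent homology *)

Section ChainMap.
Variables (k : fieldType) (V V' : choiceType) (K : complex V) (K' : complex V').
Variables (f : V -> V') (sf : simplicial K K' f).

(** A choice of support: the induced chain map needs some finite range of summation
    for each chain, and does not depend on which. *)
Definition vertices (c : chain k K) : seq V := projT1 (cid (chain_support (valP c))).

Lemma vertices_uniq c : uniq (vertices c).
Proof. by rewrite /vertices; case: cid => r []. Qed.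

Lemma vertices_supported c : supported (vertices c) (val c).
Proof. by rewrite /vertices; case: cid => r []. Qed.

Definition chain_push (c : chain k K) : chain k K' :=
  exist (fun c => c \in is_chain K') (push (vertices c) f (val c))
    (push_is_chain (vertices c) sf (valP c)).

Lemma chain_pushE r c : uniq r -> supported r (val c) ->
  val (chain_push c) = push r f (val c).
Proof.
move=> ur rc; apply: push_supported => //; first exact: vertices_uniq.
exact: vertices_supported.
Qed.

Lemma chain_push_linear : linear chain_push.
Proof.
move=> a c c'; apply/val_inj; pose r := undup (vertices c ++ vertices c').
have ur : uniq r by exact: undup_uniq.
have rc : supported r (val c).
  apply: supportedS (vertices_supported (c := c)) => u.
  by rewrite mem_undup mem_cat => ->.
have rc' : supported r (val c').
  apply: supportedS (vertices_supported (c := c')) => u.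
  by rewrite mem_undup mem_cat orbC => ->.
have rcc' : supported r (val (a *: c + c')).
  move=> s; rewrite -[_ s]/(a *: val c s + val c' s).
  have [->|/rc//] := eqVneq (val c s) 0; rewrite scaler0 add0r; exact: rc'.
rewrite (chain_pushE ur rcc') -[RHS]/(a *: val (chain_push c) + val (chain_push c')).
by rewrite (chain_pushE ur rc) (chain_pushE ur rc') -linearP.
Qed.
HB.instance Definition _ := GRing.isLinear.Build k (chain k K) (chain k K') *:%R
  chain_push chain_push_linear.

Lemma chain_push_bdry c : chain_push (chain_bdry c) = chain_bdry (chain_push c).
Proof.
apply/val_inj/funext => t; have [->|t0] := eqVneq t [::].
  exact: (chain_nil (valP (chain_push (chain_bdry c)))).
pose r := vertices c; have ur : uniq r by exact: vertices_uniq.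
have rc : supported r (val c) by exact: vertices_supported.
have rdc : supported r (bdry (val c)) by exact: supported_bdry.
rewrite (chain_pushE (c := chain_bdry c) ur rdc) /=.
pose r' := undup (map f r).
rewrite (bdryE (r := r') (undup_uniq _) _ t0); last first.
  move=> s /push_neq0[s' /rc s'r <-] x /mapP[y /s'r yr ->].
  by rewrite mem_undup map_f.
rewrite aug_bdry_push ?undup_uniq//; last by move=> x; rewrite mem_undup.
case: t t0 => // u t _; exact: (congr1 (@^~ t) (contract_push_bdry f u ur rc)).
Qed.
End ChainMap.

Section Interleaving.
Variables (k : fieldType) (R : realType).

Section PersistentPush.
Variables (V V' : choiceType) (K : filtered_complex R V) (K' : filtered_complex R V').
Variables (e : R) (f : V -> V') (sf : forall a, simplicial (K a) (K' (a + e)) f).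

Definition persistent_push_fun a :
    {linear persistent_homology k K a -> persistent_homology k K' (a + e)} :=
  homology_map (@chain_push_bdry k _ _ _ _ f (@sf a)).

Lemma persistent_push_natural a b (ab : a <= b) (abe : a + e <= b + e) x :
  pm_map (persistent_homology k K') abe (persistent_push_fun a x) =
  persistent_push_fun b (pm_map (persistent_homology k K) ab x).
Proof.
elim/homology_ind: x => z; rewrite /= /filtered_homology_map /persistent_push_fun /=.
rewrite !homology_mapE; congr homology_class; do 2!apply/val_inj => /=.
apply: push_supported; try exact: vertices_uniq.
  exact: vertices_supported.
exact: (vertices_supported (c := chain_incl _ _)).
Qed.

Definition persistent_push :
    pm_hom e (persistent_homology k K) (persistent_homology k K') :=
  PMHom persistent_push_natural.
End PersistentPush.

Lemma persistent_push_contiguous (V V' : choiceType) (K : filtered_complex R V)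
    (K' : filtered_complex R V') (e : R) (e0 : 0 <= e) (f : V -> V') (g : V' -> V)
    (sf : forall a, simplicial (K a) (K' (a + e)) f)
    (sg : forall a, simplicial (K' a) (K (a + e)) g) a x :
    contiguous (K a) (K (a + e + e)) (g \o f) id ->
  persistent_push sg (a + e) (persistent_push sf a x) =
  pm_map (persistent_homology k K) (le_shift2 a e0) x.
Proof.
move=> gf; elim/homology_ind: x => z.
rewrite /= /filtered_homology_map /persistent_push_fun /= !homology_mapE.
apply/homology_classP; pose c := val z.
pose r := vertices c; have ur : uniq r by exact: vertices_uniq.
have rc : supported r (val c) by exact: vertices_supported.
have dc : bdry (val c) = 0 by rewrite -[LHS]/(val (chain_bdry c)) (eqP (valP z)).
have [w wK dw] := push_homologous ur rc gf (valP c) dc.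
exists (exist _ w wK); apply/val_inj; rewrite /= dw -/c.
rewrite push_id// -(@push_comp _ _ _ _ _ (undup (map f r))) ?undup_uniq//; last first.
  by move=> u; rewrite mem_undup.
have fc := chain_pushE (sf a) ur rc; rewrite -fc.
have rfc : supported (undup (map f r)) (val (chain_push (sf a) c)).
  rewrite fc => t /push_neq0[s /rc sr <-] x /mapP[y /sr yr ->].
  by rewrite mem_undup map_f.
by rewrite -(chain_pushE (sg (a + e)) (undup_uniq _) rfc).
Qed.

(** The persistent form of: maps that are mutually inverse up to contiguity induce
    inverse isomorphisms in homology. *)
Lemma interleaved_contiguous (V V' : choiceType) (K : filtered_complex R V)
    (K' : filtered_complex R V') (e : R) (f : V -> V') (g : V' -> V) :
    0 <= e ->
    (forall a, simplicial (K a) (K' (a + e)) f) ->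
    (forall a, simplicial (K' a) (K (a + e)) g) ->
    (forall a, contiguous (K a) (K (a + e + e)) (g \o f) id) ->
    (forall a, contiguous (K' a) (K' (a + e + e)) (f \o g) id) ->
  interleaved e (persistent_homology k K) (persistent_homology k K').
Proof.
move=> e0 sf sg gf fg.
exists e0, (persistent_push sf), (persistent_push sg).
by split=> a x; exact: persistent_push_contiguous.
Qed.
End Interleaving.

(** * Dowker complexes *)

Section DowkerMaps.
Variables (R : realType) (L L' W W' : Type).
Variables (Lam : L -> W -> R) (Lam' : L' -> W' -> R) (e : R).
Variables (C : L -> L' -> Prop) (D : W -> W' -> Prop).
Hypothesis CDe : forall l l' w w', C l l' -> D w w' -> `|Lam l w - Lam' l' w'| <= e.
Hypothesis Dtotal : forall w, exists w', D w w'.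
Variable (f : L -> L').
Hypothesis Cf : forall l, C l (f l).

Lemma dowker_simplicial a :
  simplicial (V := {classic L}) (V' := {classic L'}) (Dow Lam a) (Dow Lam' (a + e)) f.
Proof.
move=> s [s0 [w sw]]; split.
  by move: s0; rewrite !fset_seq_neq0; case: (s).
have [w' ww'] := Dtotal w; exists w' => l'; rewrite in_fset_seq => /mapP[l ls ->].
have := CDe (Cf l) ww'; rewrite ler_distlC => /andP[_ /le_trans]; apply.
by rewrite lerD2r sw ?in_fset_seq.
Qed.

(** The witness [w] of a simplex is related to some [w'], and both [l] and [g (f l)]
    are related to [f l]. Passing through [Lam' (f l) w'] costs [e] twice, and ends
    at the witness [w] itself, which also serves for the simplex one started from. *)
Lemma dowker_contiguous (g : L' -> L) a : (forall l', C (g l') l') -> 0 <= e ->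
  contiguous (V := {classic L}) (V' := {classic L})
    (Dow Lam a) (Dow Lam (a + e + e)) (g \o f) id.
Proof.
move=> Cg e0 s [s0 [w sw]]; split.
  by move: s0; rewrite !fset_seq_neq0; case: (s).
have [w' ww'] := Dtotal w; exists w => x.
rewrite in_fset_seq mem_cat map_id => /orP[/mapP[l ls ->]|xs]; last first.
  by apply: le_trans (le_shift2 a e0); apply: sw; rewrite in_fset_seq.
have := CDe (Cf l) ww'; rewrite ler_distlC => /andP[_ fl].
have := CDe (Cg (f l)) ww'; rewrite ler_distl => /andP[_ /le_trans]; apply.
by rewrite lerD2r (le_trans fl)// lerD2r sw ?in_fset_seq.
Qed.
End DowkerMaps.

Theorem lemma4p9 (k : fieldType) (R : realType) (L L' W W' : Type)
    (Lam : L -> W -> R) (Lam' : L' -> W' -> R)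
    (C : set (L * L')) (D : set (W * W'))
    (hC : correspondence C) (hD : correspondence D)
    (eps : R) (heps : (dis Lam Lam' C D <= eps%:E)%E) :
  interleaved eps (persistent_homology k (Dow Lam)) (persistent_homology k (Dow Lam')).
Proof.
have e0 : 0 <= eps.
  rewrite -lee_fin; apply: le_trans heps.
  by apply: ereal_sup_ubound; left.
have CDe l l' w w' : C (l, l') -> D (w, w') -> `|Lam l w - Lam' l' w'| <= eps.
  move=> Cl Dw; rewrite -lee_fin; apply: le_trans heps.
  apply: (@le_trans _ _ (sup_ge0 [set `|Lam l w.1 - Lam' l' w.2|%:E | w in D])).
    by apply: ereal_sup_ubound; right; exists (w, w').
  by apply: ereal_sup_ubound; right; exists (l, l').
have [f Cf] := choice hC.1; have [g Cg] := choice hC.2.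
have CDe' l' l w' w : C (l, l') -> D (w, w') -> `|Lam' l' w' - Lam l w| <= eps.
  by rewrite distrC; exact: CDe.
apply: (@interleaved_contiguous k R {classic L} {classic L'} _ _ _ f g) => // a.
- exact: (dowker_simplicial CDe hD.1 Cf).
- exact: (dowker_simplicial CDe' hD.2 Cg).
- exact: (dowker_contiguous CDe hD.1 Cf).
- exact: (dowker_contiguous CDe' hD.2 Cg).
Qed.
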